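(* Let $(\mathfrak g,A)$ be a Lie superalgebroid, let $\epsilon\in\mathbb F$, and consider the Gerstenhaber algebra $\mathcal G=S_A(\Pi\mathfrak g)$, with parity $p$. Then any $\epsilon$-rigged representation of the Lie superalgebroid $(\mathfrak g,A)$ on a vector superspace $V$ extends uniquely to a representation $(\iota_\cdot,L_\cdot)$ of the Gerstenhaber algebra $\mathcal G$ on $V$ such that, for every (homogeneous) $X,Y\in\mathcal G$, the following $\epsilon$-right Leibniz rule holds: $$L_{X\wedge Y}=\iota_XL_Y+(-1)^{p(Y)}L_X\iota_Y-\epsilon(-1)^{p(Y)}\iota_{[X,Y]}$$ (equivalently $L_{X\wedge Y}=\iota_XL_Y+(-1)^{p(X)p(Y)}\iota_YL_X+(1-\epsilon)(-1)^{p(Y)}\iota_{[X,Y]}$).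
   Context: $\mathbb F$ is a field of characteristic $0$. For a vector superspace $V$ with parity $p$, $\Pi V$ is the same space with parity $\bar p=p+\bar 1$. $\mathrm{End}(V)$ is a Lie superalgebra with $[P,Q]=PQ-(-1)^{p(P)p(Q)}QP$. The parity of a Lie superalgebra $\mathfrak g$ is denoted $\bar p$, that of $\Pi\mathfrak g$ is denoted $p$. A *Lie superalgebroid* $(\mathfrak g,A)$: $\mathfrak g$ is a Lie superalgebra, $A$ is a (purely even) commutative associative algebra, $\mathfrak g$ is a left $A$-module, $A$ is a left $\mathfrak g$-module, and for $X,Y\in\mathfrak g$, $f,g\in A$: $(fX)(g)=f(X(g))$, $X(fg)=X(f)g+fX(g)$, $[X,fY]=X(f)Y+f[X,Y]$. The Lie superalgebra $\mathfrak g\ltimes\Pi A$ is $\mathfrak g\oplus\Pi A$ with bracket extending that of $\mathfrak g$ by $[f,g]=0$, $[X,f]=X(f)$, and $[f,X]$ determined by skewcommutativity ($f,g\in\Pi A$, $X\in\mathfrak g$). A *rigged representation* of a Lie superalgebra $\mathfrak h$ on $V$ is a representation $L_\cdot:\mathfrak h\to\mathrm{End}(V)$ with an even linear map $\iota_\cdot:\Pi\mathfrak h\to\mathrm{End}(V)$ such that $[\iota_X,\iota_Y]=0$ and $[L_X,\iota_Y]=\iota_{[X,Y]}$ for all $X,Y\in\mathfrak h$. An *$\epsilon$-rigged representation* of $(\mathfrak g,A)$ on $V$ is a left $A$-module structure $\iota_\cdot:A\to\mathrm{End}(V)$ together with a rigged representation of $\mathfrak g\ltimes\Pi A$ on $V$,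 given by maps $\iota_\cdot:\Pi\mathfrak g\oplus A\to\mathrm{End}(V)$ (extending the $A$-module structure) and $L_\cdot:\mathfrak g\oplus\Pi A\to\mathrm{End}(V)$, such that for $f,g\in A$, $X\in\mathfrak g$: (i) $L_{fg}=L_f\iota_g+\iota_fL_g$; (ii) $\iota_{fX}=\iota_f\iota_X$; (iii) $L_{fX}=\iota_fL_X-(-1)^{\bar p(X)}L_f\iota_X-\epsilon\,\iota_{X(f)}$. A *Gerstenhaber algebra* is a vector superspace $\mathcal G$ with parity $p$, a product $\wedge$ and a bracket $[\cdot,\cdot]$ such that $(\mathcal G,\wedge)$ is a commutative associative superalgebra, $(\Pi\mathcal G,[\cdot,\cdot])$ is a Lie superalgebra, and $[X,Y\wedge Z]=[X,Y]\wedge Z+(-1)^{(p(X)+\bar 1)p(Y)}Y\wedge[X,Z]$. $S_A(\Pi\mathfrak g)$ (symmetric superalgebra over $A$ of the $A$-module $\Pi\mathfrak g$, with degree-$0$ part $A$) is the Gerstenhaber algebra whose $\wedge$ is the product of the symmetric superalgebra and whose bracket (the Schouten bracket) is the unique Gerstenhaber bracket extending the bracket of $\mathfrak g\ltimes\Pi A$. A *representation* of a Gerstenhaber algebra $\mathcal G$ on a superspace $V$ is a module structure $X\mapsto\iota_X$ over the superalgebra $(\mathcal G,\wedge)$ together with a module structure $X\mapsto L_X$ over the Lie superalgebra $(\Pi\mathcal G,[\cdot,\cdot])$ such that $[L_X,\iota_Y]=L_X\iota_Y-(-1)^{(p(X)+\bar1)p(Y)}\iota_YL_X=\iota_{[X,Y]}$.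 ''Extends'' means that $\iota$ and $L$ restrict to the given maps on $\Pi\mathfrak g\oplus A$ and $\mathfrak g\oplus\Pi A$ respectively. *)

(* Defs.v *)
From HB Require Import structures.
From mathcomp Require Import all_boot all_algebra.
Set Implicit Arguments.
Unset Strict Implicit.
Unset Printing Implicit Defensive.
Import GRing.Theory.
Local Open Scope ring_scope.

(* Parities are booleans: [false] is even, [true] is odd, their sum is [(+)],
   and [(-1) ^+ (i && j)] is the usual sign $(-1)^{ij}$.
   Identities whose signs involve the parity of an element are imposed on
   homogeneous elements only; the operations are bilinear on the whole space. *)

Record superspace (F : fieldType) := Superspace {
  ss_lmod :> lmodType F;
  homog : bool -> ss_lmod -> Prop;
  homog_lin : forall i (a : F) (x y : ss_lmod),
    homog i x -> homog i y -> homog i (a *: x + y);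
  homog_decomp : forall x : ss_lmod,
    exists x0 x1, [/\ homog false x0, homog true x1 & x = x0 + x1];
  homog_disjoint : forall x : ss_lmod, homog false x -> homog true x -> x = 0
}.

Definition purely_even (F : fieldType) (V : superspace F) : Prop :=
  forall x : V, homog true x -> x = 0.

Lemma Pi_decomp (F : fieldType) (V : superspace F) (x : V) :
  exists x0 x1, [/\ homog (~~ false) x0, homog (~~ true) x1 & x = x0 + x1].
Proof.
by have [x0 [x1 [h0 h1 ->]]] := homog_decomp x; exists x1, x0; split=> //; rewrite addrC.
Qed.

Definition Pi (F : fieldType) (V : superspace F) : superspace F :=
  @Superspace F V (fun i => @homog F V (~~ i)) (fun i => @homog_lin F V (~~ i))
    (@Pi_decomp F V) (fun x h0 h1 => @homog_disjoint F V x h1 h0).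

Lemma homog0 (F : fieldType) (V : superspace F) i : homog i (0 : V).
Proof.
have [x0 [x1 [h0 h1 _]]] := @homog_decomp F V 0.
by case: i; [have := homog_lin (-1) h1 h1 | have := homog_lin (-1) h0 h0];
  rewrite scaleN1r addNr.
Qed.

Definition dsum_homog (F : fieldType) (U V : superspace F) (i : bool)
  (x : (U * V)%type) : Prop := homog i x.1 /\ homog i x.2.

Lemma dsum_lin (F : fieldType) (U V : superspace F) i (a : F) (x y : (U * V)%type) :
  dsum_homog i x -> dsum_homog i y -> dsum_homog i (a *: x + y).
Proof. by case=> ? ? [? ?]; split; apply: homog_lin. Qed.

Lemma dsum_decomp (F : fieldType) (U V : superspace F) (x : (U * V)%type) :
  exists x0 x1, [/\ dsum_homog false x0, dsum_homog true x1 & x = x0 + x1].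
Proof.
case: x => u v; have [u0 [u1 [? ? ->]]] := homog_decomp u.
have [v0 [v1 [? ? ->]]] := homog_decomp v.
by exists (u0, v0), (u1, v1); split.
Qed.

Lemma dsum_disjoint (F : fieldType) (U V : superspace F) (x : (U * V)%type) :
  dsum_homog false x -> dsum_homog true x -> x = 0.
Proof.
by case: x => u v [/= ? ?] [/= ? ?]; congr (_, _); apply: homog_disjoint.
Qed.

Definition dsum (F : fieldType) (U V : superspace F) : superspace F :=
  @Superspace F (U * V)%type (@dsum_homog F U V) (@dsum_lin F U V)
    (@dsum_decomp F U V) (@dsum_disjoint F U V).

Definition even_linear (F : fieldType) (U V : superspace F) (f : U -> V) : Prop :=
  linear f /\ (forall i x, homog i x -> homog i (f x)).

(* An even linear map $U\to\mathrm{End}(V)$ is represented by the corresponding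
   even bilinear map [U -> V -> V]. *)
Definition even_bilinear (F : fieldType) (U V W : superspace F)
    (f : U -> V -> W) : Prop :=
  [/\ forall y, linear (f^~ y), forall x, linear (f x)
    & forall i j x y, homog i x -> homog j y -> homog (i (+) j) (f x y)].

(* The bracket $[P,Q]$ of $\mathrm{End}(V)$, for [P] of parity [i] and [Q] of
   parity [j]. *)
Definition scomm (F : fieldType) (V : superspace F) (i j : bool)
  (P Q : V -> V) (v : V) : V := P (Q v) - (-1) ^+ (i && j) *: Q (P v).

Record is_lie (F : fieldType) (V : superspace F) (br : V -> V -> V) : Prop := IsLie {
  lie_bilinear : even_bilinear br;
  lie_skew : forall i j x y, homog i x -> homog j y ->
    br x y = - ((-1) ^+ (i && j) *: br y x);
  lie_jacobi : forall i j x y z, homog i x -> homog j y ->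
    br x (br y z) = br (br x y) z + (-1) ^+ (i && j) *: br y (br x z)
}.

Record lieSuperalgebra (F : fieldType) := LieSuperalgebra {
  lie_space :> superspace F;
  lie_bracket : lie_space -> lie_space -> lie_space;
  lie_axioms : is_lie lie_bracket
}.

Record is_lie_module (F : fieldType) (h : lieSuperalgebra F) (V : superspace F)
    (L : h -> V -> V) : Prop := IsLieModule {
  lie_module_bilinear : even_bilinear L;
  lie_module_bracket : forall i j X Y v, homog i X -> homog j Y ->
    L (lie_bracket X Y) v = scomm i j (L X) (L Y) v
}.

Record comSuperalgebra (F : fieldType) := ComSuperalgebra {
  csa_space :> superspace F;
  csa_mul : csa_space -> csa_space -> csa_space;
  csa_one : csa_space;
  csa_bilinear : even_bilinear csa_mul;
  csa_mulA : associative csa_mul;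
  csa_one_even : homog false csa_one;
  csa_mul1 : left_id csa_one csa_mul;
  csa_mulC : forall i j x y, homog i x -> homog j y ->
    csa_mul x y = (-1) ^+ (i && j) *: csa_mul y x
}.

Record is_csa_module (F : fieldType) (B : comSuperalgebra F) (V : superspace F)
    (act : B -> V -> V) : Prop := IsCsaModule {
  csa_module_bilinear : even_bilinear act;
  csa_module_one : forall v, act (csa_one B) v = v;
  csa_module_mul : forall x y v, act (csa_mul x y) v = act x (act y v)
}.

Record is_csa_hom (F : fieldType) (B C : comSuperalgebra F) (h : B -> C) : Prop :=
  IsCsaHom {
  csa_hom_even_linear : even_linear h;
  csa_hom_one : h (csa_one B) = csa_one C;
  csa_hom_mul : forall x y, h (csa_mul x y) = csa_mul (h x) (h y)
}.

Record lieSuperalgebroid (F : fieldType) (g : lieSuperalgebra F)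
    (A : comSuperalgebra F) := LieSuperalgebroid {
  lad_scale : A -> g -> g;
  lad_anchor : g -> A -> A;
  lad_even : purely_even A;
  lad_csa_module : is_csa_module lad_scale;
  lad_lie_module : is_lie_module lad_anchor;
  lad_anchor_scale : forall f X h,
    lad_anchor (lad_scale f X) h = csa_mul f (lad_anchor X h);
  lad_anchor_mul : forall X f h, lad_anchor X (csa_mul f h) =
    csa_mul (lad_anchor X f) h + csa_mul f (lad_anchor X h);
  lad_bracket_scale : forall X f Y, lie_bracket X (lad_scale f Y) =
    lad_scale (lad_anchor X f) Y + lad_scale f (lie_bracket X Y)
}.

(* The bracket of $\mathfrak g\ltimes\Pi A$. Skewcommutativity prescribes
   $[f,Y]=-(-1)^{\bar p(Y)}Y(f)$ ([f] is odd in $\Pi A$); this is $-Y(f)$ for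
   every [Y], because an odd [Y] acts by zero on the purely even [A]. *)
Definition semidirect_bracket (F : fieldType) (g : lieSuperalgebra F)
    (A : comSuperalgebra F) (gA : lieSuperalgebroid g A)
    (x y : dsum g (Pi A)) : dsum g (Pi A) :=
  (lie_bracket x.1 y.1, lad_anchor gA x.1 y.2 - lad_anchor gA y.1 x.2).

Lemma purely_even_homog (F : fieldType) (A : superspace F) (f : A) :
  purely_even A -> homog false f.
Proof.
by move=> hA; have [f0 [f1 [h0 /hA -> ->]]] := homog_decomp f; rewrite addr0.
Qed.

Lemma anchor_odd (F : fieldType) (g : lieSuperalgebra F)
    (A : comSuperalgebra F) (gA : lieSuperalgebroid g A) (X : g) (f : A) :
  homog true X -> lad_anchor gA X f = 0.
Proof.
move=> hX; apply: (lad_even gA).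
have [[_ _ h] _] := lad_lie_module gA.
by rewrite -[true]/(true (+) false); apply: h => //; apply: purely_even_homog (lad_even gA).
Qed.

Lemma semidirect_is_lie (F : fieldType) (g : lieSuperalgebra F)
    (A : comSuperalgebra F) (gA : lieSuperalgebroid g A) :
  is_lie (semidirect_bracket gA).
Proof.
have [[bl br bh] bs bj] := lie_axioms g.
have [[al ar ah] am] := lad_lie_module gA.
have A1 (f : A) : homog true f -> f = 0 by apply: (lad_even gA).
have X1 := @anchor_odd F g A gA.
have a0 X : lad_anchor gA X 0 = 0.
  by have := ar X (-1) 0 0; rewrite !scaleN1r !addNr.
have aB X u v : lad_anchor gA X (u - v) = lad_anchor gA X u - lad_anchor gA X v.
  by rewrite -[u - v]addrC -scaleN1r ar scaleN1r addrC.
split.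
- split.
  + move=> y a x x'; rewrite /semidirect_bracket /= bl al ar.
    congr (_, _) => /=.
    by rewrite scalerBr opprD !addrA; congr (_ - _); rewrite -!addrA; congr (_ + _); rewrite addrC.
  + move=> x a y y'; rewrite /semidirect_bracket /= br al ar.
    congr (_, _) => /=.
    by rewrite scalerBr opprD !addrA; congr (_ - _); rewrite -!addrA; congr (_ + _); rewrite addrC.
  + move=> i j [X f] [Y h] [/= hX hf] [/= hY hh]; split=> /=; first exact: bh.
    case: i j hX hf hY hh => -[] hX hf hY hh /=.
    * by rewrite !X1 // subrr; apply: homog0.
    * exact: purely_even_homog (lad_even gA).
    * exact: purely_even_homog (lad_even gA).
    * by rewrite (A1 f) // (A1 h) // !a0 subr0; apply: homog0.
- move=> i j [X f] [Y h] [/= hX hf] [/= hY hh]; congr (_, _) => /=.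
    exact: bs.
  case: i j hX hf hY hh => -[] hX hf hY hh; rewrite /= ?expr0 ?expr1.
  + by rewrite !X1 // subrr scaler0 oppr0.
  + by rewrite scale1r opprB.
  + by rewrite scale1r opprB.
  + by rewrite scale1r opprB.
move=> i j [X f] [Y h] [Z e] [/= hX hf] [/= hY hh]; congr (_, _) => /=.
  exact: bj.
have [Z0 [Z1 [hZ0 hZ1 eZ]]] := homog_decomp Z.
have aZ u : lad_anchor gA Z u = lad_anchor gA Z0 u.
  by have := al u 1 Z0 Z1; rewrite /= !scale1r -eZ (X1 Z1) ?addr0.
have bZ i' (W : g) u : homog i' W ->
    lad_anchor gA (lie_bracket W Z) u =
    lad_anchor gA W (lad_anchor gA Z u) - lad_anchor gA Z (lad_anchor gA W u).
  move=> hW; have -> : lie_bracket W Z = 1 *: lie_bracket W Z0 + lie_bracket W Z1.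
    by rewrite eZ -[in LHS](scale1r Z0) br.
  rewrite al scale1r (am _ _ _ _ _ hW hZ0) (am _ _ _ _ _ hW hZ1) /scomm andbF expr0 scale1r.
  rewrite !(X1 Z1) // a0 scaler0 subr0 addr0 !aZ //.
rewrite !(aB, bZ _ _ _ hX, bZ _ _ _ hY, am _ _ _ _ _ hX hY, aZ) /scomm.
case: i j hX hf hY hh => -[] hX hf hY hh; rewrite /= ?expr0 ?expr1.
- by rewrite !(X1 X) ?(X1 Y) ?a0 // !(subr0, scaler0, addr0, oppr0, add0r, subrr).
- rewrite (A1 h) // !(X1 X) // !a0 !(subr0, scaler0, addr0, oppr0, add0r, subrr).
  by rewrite scale1r opprB opprK.
- rewrite (A1 f) // !(X1 Y) // !a0 !(subr0, scaler0, addr0, oppr0, add0r, subrr).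
  by rewrite scale1r opprB addKr.
rewrite (A1 f) // (A1 h) // !a0 !(subr0, scaler0, addr0, oppr0, add0r, subrr) !scale1r.
by rewrite subrK.
Qed.

Definition semidirect (F : fieldType) (g : lieSuperalgebra F)
    (A : comSuperalgebra F) (gA : lieSuperalgebroid g A) : lieSuperalgebra F :=
  LieSuperalgebra (semidirect_is_lie gA).

Record is_rigged (F : fieldType) (h : lieSuperalgebra F) (V : superspace F)
    (iota : Pi h -> V -> V) (L : h -> V -> V) : Prop := IsRigged {
  rigged_lie_module : is_lie_module L;
  rigged_bilinear : even_bilinear iota;
  rigged_iota : forall i j (X Y : Pi h) v, homog i X -> homog j Y ->
    scomm i j (iota X) (iota Y) v = 0;
  rigged_L_iota : forall i j (X : h) (Y : Pi h) v, homog i X -> homog j Y ->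
    scomm i j (L X) (iota Y) v = iota (lie_bracket (X : h) (Y : h)) v
}.

(* The maps [iota] and [L] on $\Pi\mathfrak g\oplus A$ and
   $\mathfrak g\oplus\Pi A$ are maps on pairs; [X] in $\mathfrak g$ is [(X, 0)]
   and [f] in [A] is [(0, f)]. *)
Record is_eps_rigged (F : fieldType) (g : lieSuperalgebra F)
    (A : comSuperalgebra F) (gA : lieSuperalgebroid g A) (eps : F)
    (V : superspace F)
    (iota : Pi (semidirect gA) -> V -> V) (L : semidirect gA -> V -> V) : Prop :=
  IsEpsRigged {
  eps_csa_module : is_csa_module (fun f : A => iota (0, f));
  eps_rigged : is_rigged iota L;
  eps_L_mul : forall (f h : A) v,
    L (0, csa_mul f h) v = L (0, f) (iota (0, h) v) + iota (0, f) (L (0, h) v);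
  eps_iota_scale : forall (f : A) (X : g) v,
    iota (lad_scale gA f X, 0) v = iota (0, f) (iota (X, 0) v);
  eps_L_scale : forall i (f : A) (X : g) v, homog i X ->
    L (lad_scale gA f X, 0) v =
      iota (0, f) (L (X, 0) v) - (-1) ^+ i *: L (0, f) (iota (X, 0) v)
      - eps *: iota (0, lad_anchor gA X f) v
}.

Record gerstenhaber (F : fieldType) := Gerstenhaber {
  gerst_csa :> comSuperalgebra F;
  gerst_bracket : gerst_csa -> gerst_csa -> gerst_csa;
  gerst_is_lie : @is_lie F (Pi gerst_csa) gerst_bracket;
  gerst_leibniz : forall i j (X Y Z : gerst_csa), homog i X -> homog j Y ->
    gerst_bracket X (csa_mul Y Z) = csa_mul (gerst_bracket X Y) Z
      + (-1) ^+ ((i (+) true) && j) *: csa_mul Y (gerst_bracket X Z)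
}.

Definition gerst_lie (F : fieldType) (G : gerstenhaber F) : lieSuperalgebra F :=
  LieSuperalgebra (@gerst_is_lie F G).

Record is_gerst_rep (F : fieldType) (G : gerstenhaber F) (V : superspace F)
    (iota : G -> V -> V) (L : gerst_lie G -> V -> V) : Prop := IsGerstRep {
  gerst_rep_csa_module : is_csa_module iota;
  gerst_rep_lie_module : is_lie_module L;
  gerst_rep_L_iota : forall i j (X Y : G) v, homog i X -> homog j Y ->
    scomm (i (+) true) j (L X) (iota Y) v = iota (gerst_bracket X Y) v
}.

(* Even [A]-linear maps from the [A]-module [M] to the [A]-algebra [B] with
   structure map [a]. *)
Definition is_sym_pair (F : fieldType) (A : comSuperalgebra F) (M : superspace F)
    (act : A -> M -> M) (B : comSuperalgebra F) (a : A -> B) (m : M -> B) : Prop :=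
  [/\ is_csa_hom a, even_linear m
    & forall f x, m (act f x) = csa_mul (a f) (m x)].

(* [S], with the canonical maps [a : A -> S] and [m : M -> S], is the symmetric
   superalgebra $S_A(M)$: the universal commutative [A]-superalgebra receiving
   an even [A]-linear map from [M]. *)
Definition is_sym_superalgebra (F : fieldType) (A : comSuperalgebra F)
    (M : superspace F) (act : A -> M -> M)
    (S : comSuperalgebra F) (a : A -> S) (m : M -> S) : Prop :=
  is_sym_pair act a m /\
  forall (B : comSuperalgebra F) (a' : A -> B) (m' : M -> B),
    is_sym_pair act a' m' ->
    exists h : S -> B,
      [/\ is_csa_hom h, h \o a =1 a', h \o m =1 m'
        & forall h' : S -> B, is_csa_hom h' -> h' \o a =1 a' -> h' \o m =1 m' ->
            h' =1 h].

Definition sym_gen (F : fieldType) (g : lieSuperalgebra F)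
    (A : comSuperalgebra F) (gA : lieSuperalgebroid g A) (G : gerstenhaber F)
    (a : A -> G) (m : Pi g -> G) (x : semidirect gA) : G := m x.1 + a x.2.

(* The Schouten bracket is the unique Gerstenhaber bracket on $S_A(\Pi\mathfrak g)$
   extending that of $\mathfrak g\ltimes\Pi A$, so the second clause pins down the
   bracket of [G]. *)
Definition is_schouten_algebra (F : fieldType) (g : lieSuperalgebra F)
    (A : comSuperalgebra F) (gA : lieSuperalgebroid g A) (G : gerstenhaber F)
    (a : A -> G) (m : Pi g -> G) : Prop :=
  is_sym_superalgebra (M := Pi g) (lad_scale gA) a m /\
  forall x y : semidirect gA,
    gerst_bracket (sym_gen a m x) (sym_gen a m y) = sym_gen a m (lie_bracket x y).

Definition right_leibniz (F : fieldType) (G : gerstenhaber F) (V : superspace F)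
    (eps : F) (iota : G -> V -> V) (L : gerst_lie G -> V -> V) : Prop :=
  forall i j (X Y : G) v, homog i X -> homog j Y ->
    L (csa_mul X Y) v = iota X (L Y v) + (-1) ^+ j *: L X (iota Y v)
      - (eps * (-1) ^+ j) *: iota (gerst_bracket X Y) v.

Definition right_leibniz' (F : fieldType) (G : gerstenhaber F) (V : superspace F)
    (eps : F) (iota : G -> V -> V) (L : gerst_lie G -> V -> V) : Prop :=
  forall i j (X Y : G) v, homog i X -> homog j Y ->
    L (csa_mul X Y) v = iota X (L Y v) + (-1) ^+ (i && j) *: iota Y (L X v)
      + ((1 - eps) * (-1) ^+ j) *: iota (gerst_bracket X Y) v.

(* Main.v *)
(* The operators iota0 supercommute, so they lie in a commutative subalgebra of
   End(V) (their bicommutant), and the universal property of the symmetric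
   superalgebra G yields iota.

   For L, equip the pairs (X, T) in G x End(V) with the product
     (X, T) (Y, S) = (X Y, iota_X S + (-1)^p(Y) T iota_Y - eps (-1)^p(Y) iota_[X, Y])
   dictated by the right Leibniz rule. The pairs such that [T, iota_Y] = iota_[X, Y]
   for all Y form a commutative associative superalgebra, because the bracket is a
   symmetric Hochschild cocycle and the commutation relation absorbs the defect of
   symmetry of the other two terms. The maps f |-> (f, L0_f) and X |-> (X, L0_X) are
   multiplicative by the axioms of an eps-rigged representation, hence extend to G,
   and the second component of the extension is L. The defect L_[X, Y] - [L_X, L_Y]
   satisfies a Leibniz rule in Y, so it vanishes since it vanishes on generators. *)
Require Import Defs.
From HB Require Import structures.
From mathcomp Require Import all_boot all_algebra.
From mathcomp Require Import boolp functions ring.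
Set Implicit Arguments.
Unset Strict Implicit.
Unset Printing Implicit Defensive.
Import GRing.Theory.
Local Open Scope ring_scope.

(** * Deciding linear identities in a module by comparing coefficients *)

Inductive lin_expr (F : Type) :=
  | LVar of nat
  | LZero
  | LAdd of lin_expr F & lin_expr F
  | LOpp of lin_expr F
  | LScale of F & lin_expr F.
Arguments LVar {F}.
Arguments LZero {F}.

Fixpoint lin_eval (F : fieldType) (V : lmodType F) (e : seq V) (t : lin_expr F) : V :=
  match t with
  | LVar n => nth 0 e n
  | LZero => 0
  | LAdd t u => lin_eval e t + lin_eval e u
  | LOpp t => - lin_eval e t
  | LScale c t => c *: lin_eval e t
  end.

Fixpoint lin_coef (F : fieldType) (t : lin_expr F) (i : nat) : F :=
  match t with
  | LVar n => if eqn i n then 1 else 0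
  | LZero => 0
  | LAdd t u => lin_coef t i + lin_coef u i
  | LOpp t => - lin_coef t i
  | LScale c t => c * lin_coef t i
  end.

(** This computes to a conjunction with one scalar equation per atom, so that [ring] can settle each
    of them. *)
Fixpoint coef_eq (F : fieldType) (t u : lin_expr F) (n : nat) : Prop :=
  if n is n'.+1 then lin_coef t n' = lin_coef u n' /\ coef_eq t u n' else True.

Lemma lin_evalE (F : fieldType) (V : lmodType F) (e : seq V) (t : lin_expr F) :
  lin_eval e t = \sum_(i < size e) lin_coef t i *: e`_i.
Proof.
elim: t => /= [n||t -> u ->|t ->|c t ->].
- have [hn|hn] := ltnP n (size e).
    rewrite (bigD1 (Ordinal hn)) //= eqnE eqxx scale1r big1 ?addr0 // => i.
    by rewrite -val_eqE /= => /negPf hi; rewrite hi scale0r.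
  rewrite nth_default // big1 // => i _; rewrite eqnE.
  by case: eqP => [hi|_]; rewrite ?scale0r //; move: (ltn_ord i); rewrite hi ltnNge hn.
- by rewrite big1 // => i _; rewrite scale0r.
- by rewrite -big_split; apply: eq_bigr => i _; rewrite scalerDl.
- by rewrite -sumrN; apply: eq_bigr => i _; rewrite scaleNr.
- by rewrite scaler_sumr; apply: eq_bigr => i _; rewrite scalerA.
Qed.

Lemma lin_eval_eq (F : fieldType) (V : lmodType F) (e : seq V) (t u : lin_expr F) :
  coef_eq t u (size e) -> lin_eval e t = lin_eval e u.
Proof.
rewrite !lin_evalE => h; apply: eq_bigr => -[i hi] _ /=; congr (_ *: _).
elim: (size e) h hi => [//|n IH] [hn h]; rewrite ltnS leq_eqVlt.
by case/orP=> [/eqP->//|]; apply: IH.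
Qed.

Ltac in_seq x e :=
  lazymatch e with
  | nil => constr:(false)
  | x :: _ => constr:(true)
  | _ :: ?e' => in_seq x e'
  end.
Ltac atoms t e :=
  lazymatch t with
  | GRing.zero => e
  | GRing.add ?t ?u => let e' := atoms t e in atoms u e'
  | GRing.opp ?t => atoms t e
  | GRing.scale _ ?t => atoms t e
  | ?x => lazymatch in_seq x e with true => e | false => constr:(x :: e) end
  end.
Ltac index_in x e :=
  lazymatch e with
  | x :: _ => constr:(0%N)
  | _ :: ?e' => let n := index_in x e' in constr:(n.+1)
  end.
Ltac reify F t e :=
  lazymatch t with
  | GRing.zero => constr:(@LZero F)
  | GRing.add ?t ?u => let t' := reify F t e in let u' := reify F u e in constr:(@LAdd F t' u')
  | GRing.opp ?t => let t' := reify F t e in constr:(@LOpp F t')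
  | GRing.scale ?c ?t => let t' := reify F t e in constr:(@LScale F c t')
  | ?x => let n := index_in x e in constr:(@LVar F n)
  end.
(* Proves an equality of linear combinations in an [F]-module, by comparing the
   coefficients of each atom with [ring]. *)
Ltac module F :=
  lazymatch goal with
  | |- @eq ?V ?t ?u =>
    let e := atoms t (@nil V) in
    let e := atoms u e in
    let t' := reify F t e in
    let u' := reify F u e in
    refine (@lin_eval_eq F _ e t' u' _);
    cbn [coef_eq size lin_coef eqn];
    repeat split; ring
  end.

(** * Elementary facts on linear maps and homogeneous elements *)

Section LinearMaps.
Variables (F : fieldType) (U V : lmodType F) (f : U -> V).
Hypothesis fL : linear f.

Lemma linearP_D x y : f (x + y) = f x + f y.
Proof. by have := fL 1 x y; rewrite !scale1r. Qed.

Lemma linearP_0 : f 0 = 0.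
Proof. by have /(congr1 (+%R^~ (- f 0))) := linearP_D 0 0; rewrite addr0 addrK subrr. Qed.

Lemma linearP_Z c x : f (c *: x) = c *: f x.
Proof. by have := fL c x 0; rewrite !addr0 linearP_0 addr0. Qed.

Lemma linearP_N x : f (- x) = - f x.
Proof. by rewrite -scaleN1r linearP_Z scaleN1r. Qed.

Definition linearPE := (linearP_D, linearP_Z, linearP_N, linearP_0).

End LinearMaps.

Lemma homogD (F : fieldType) (V : superspace F) i (x y : V) :
  homog i x -> homog i y -> homog i (x + y).
Proof. by move=> hx hy; rewrite -[x]scale1r; apply: homog_lin. Qed.

Lemma homogZ (F : fieldType) (V : superspace F) i c (x : V) :
  homog i x -> homog i (c *: x).
Proof. by move=> hx; rewrite -[_ *: _]addr0; apply: homog_lin => //; apply: homog0. Qed.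

(** * Commutative graded subalgebras and the universal property *)

(** The ambient [E] carries no grading of its own: below it is the space of all functions [V -> V],
    linear or not, or the product of [G] with it. Only the sum of the two pieces becomes a
    superspace. *)
Record graded_subspace (F : fieldType) (E : lmodType F) := GradedSubspace {
  piece :> bool -> E -> Prop;
  piece0 : forall i, piece i 0;
  piece_lin : forall i c x y, piece i x -> piece i y -> piece i (c *: x + y);
  piece_disjoint : forall x, piece false x -> piece true x -> x = 0
}.

Section Span.
Variables (F : fieldType) (E : lmodType F) (W : graded_subspace E).

Definition in_span : {pred E} := fun x =>
  `[< exists x0 x1, [/\ W false x0, W true x1 & x = x0 + x1] >].

Lemma in_spanP x :
  reflect (exists x0 x1, [/\ W false x0, W true x1 & x = x0 + x1]) (x \in in_span).
Proof. exact: asboolP. Qed.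

Lemma piece_span i x : W i x -> x \in in_span.
Proof.
have w0 := piece0 W; case: i => h; apply/in_spanP.
  by exists 0, x; rewrite add0r.
by exists x, 0; rewrite addr0.
Qed.

Lemma span_submod_closed : submod_closed in_span.
Proof.
split; first exact: piece_span (piece0 W false).
move=> c x y /in_spanP [x0 [x1 [h0 h1 ->]]] /in_spanP [y0 [y1 [k0 k1 ->]]].
apply/in_spanP; exists (c *: x0 + y0), (c *: x1 + y1); split; try exact: piece_lin.
module F.
Qed.

HB.instance Definition _ := GRing.isSubmodClosed.Build F E in_span span_submod_closed.

Record span := Span { span_val :> E; span_valP : span_val \in in_span }.
HB.instance Definition _ := [isSub for span_val].
HB.instance Definition _ := [Choice of span by <:].
HB.instance Definition _ := [SubChoice_isSubLmodule of span by <:].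

Definition span_homog (i : bool) (x : span) : Prop := W i (span_val x).

Lemma span_homog_lin i c (x y : span) :
  span_homog i x -> span_homog i y -> span_homog i (c *: x + y).
Proof. exact: piece_lin. Qed.

Lemma span_homog_decomp (x : span) :
  exists x0 x1, [/\ span_homog false x0, span_homog true x1 & x = x0 + x1].
Proof.
have /in_spanP [x0 [x1 [h0 h1 e]]] := span_valP x.
exists (Span (piece_span h0)), (Span (piece_span h1)); split=> //.
exact: val_inj.
Qed.

Lemma span_homog_disjoint (x : span) :
  span_homog false x -> span_homog true x -> x = 0.
Proof. by move=> h0 h1; apply: val_inj; apply: piece_disjoint h0 h1. Qed.

Definition span_superspace : superspace F :=
  Superspace span_homog_lin span_homog_decomp span_homog_disjoint.

End Span.

Section SpanAlgebra.
Variables (F : fieldType) (E : lmodType F) (W : graded_subspace E).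
Variables (mul : E -> E -> E) (one : E).

(** Linearity on the right is asked only when the left factor lies in a piece: $P\circ Q$ is linear
    in $P$ for arbitrary functions, but linear in $Q$ only when $P$ is linear. *)
Record is_graded_alg : Prop := IsGradedAlg {
  ga_linl : forall y, linear (mul^~ y);
  ga_linr : forall i x, W i x -> linear (mul x);
  ga_mul : forall i j x y, W i x -> W j y -> W (i (+) j) (mul x y);
  ga_mulA : forall i j k x y z, W i x -> W j y -> W k z ->
    mul x (mul y z) = mul (mul x y) z;
  ga_one : W false one;
  ga_mul1 : forall i x, W i x -> mul one x = x;
  ga_mulC : forall i j x y, W i x -> W j y -> mul x y = (-1) ^+ (i && j) *: mul y x
}.

Hypothesis GA : is_graded_alg.

Lemma span_linr x : x \in in_span W -> linear (mul x).
Proof.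
case/in_spanP=> x0 [x1 [h0 h1 ->]] c y z.
rewrite !(linearP_D (ga_linl GA _)) !(ga_linr GA h0) !(ga_linr GA h1).
module F.
Qed.

Lemma span_mul x y : x \in in_span W -> y \in in_span W -> mul x y \in in_span W.
Proof.
case/in_spanP=> x0 [x1 [h0 h1 ->]] /in_spanP [y0 [y1 [k0 k1 ->]]].
rewrite (linearP_D (ga_linl GA _)) (linearP_D (ga_linr GA h0)) (linearP_D (ga_linr GA h1)).
by rewrite !rpredD //; apply: piece_span; apply: ga_mul; eassumption.
Qed.

Definition span_mulf (x y : span W) : span W := Span (span_mul (span_valP x) (span_valP y)).
Definition span_one : span W := Span (piece_span (ga_one GA)).

Lemma span_mulf_bilinear :
  @even_bilinear F (span_superspace W) (span_superspace W) (span_superspace W) span_mulf.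
Proof.
split=> [y c x x'|x c y y'|i j x y]; try apply: val_inj => /=.
- exact: (ga_linl GA).
- exact: (span_linr (span_valP x)).
- exact: ga_mul.
Qed.

Lemma span_mulfA : associative span_mulf.
Proof.
move=> x y z; apply: val_inj => /=.
have /in_spanP [x0 [x1 [h0 h1 ->]]] := span_valP x.
have /in_spanP [y0 [y1 [k0 k1 ->]]] := span_valP y.
have /in_spanP [z0 [z1 [l0 l1 ->]]] := span_valP z.
rewrite !(linearP_D (ga_linl GA _)).
rewrite !(linearP_D (ga_linr GA h0)) !(linearP_D (ga_linr GA h1)).
rewrite !(linearP_D (ga_linl GA _)).
rewrite !(linearP_D (ga_linr GA k0)) !(linearP_D (ga_linr GA k1)).
rewrite !(linearP_D (ga_linr GA h0)) !(linearP_D (ga_linr GA h1)).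
have mR i j u w : W i u -> W j w -> linear (mul (mul u w)).
  by move=> hu hw; apply: (@ga_linr GA); apply: (@ga_mul GA); eassumption.
rewrite !(linearP_D (mR _ _ _ _ h0 k0)) !(linearP_D (mR _ _ _ _ h0 k1)).
rewrite !(linearP_D (mR _ _ _ _ h1 k0)) !(linearP_D (mR _ _ _ _ h1 k1)).
do !(erewrite (ga_mulA GA); [|eassumption..]).
module F.
Qed.

Lemma span_one_even : homog false (span_one : span_superspace W).
Proof. exact: (ga_one GA). Qed.

Lemma span_mul1 : left_id span_one span_mulf.
Proof.
move=> x; apply: val_inj => /=.
have /in_spanP [x0 [x1 [h0 h1 ->]]] := span_valP x.
by rewrite (linearP_D (ga_linr GA (ga_one GA))) (ga_mul1 GA h0) (ga_mul1 GA h1).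
Qed.

Lemma span_mulfC i j (x y : span_superspace W) : homog i x -> homog j y ->
  span_mulf x y = (-1) ^+ (i && j) *: span_mulf y x.
Proof. by move=> hx hy; apply: val_inj; apply: (ga_mulC GA). Qed.

Definition span_csa : comSuperalgebra F :=
  ComSuperalgebra span_mulf_bilinear span_mulfA span_one_even span_mul1 span_mulfC.

End SpanAlgebra.

Section SymmetricSuperalgebra.
Variables (F : fieldType) (A : comSuperalgebra F) (M : superspace F).
Variables (act : A -> M -> M) (S : comSuperalgebra F) (a : A -> S) (m : M -> S).
Hypothesis symS : is_sym_superalgebra act a m.

(** The universal property of [S] is applied to the superalgebra spanned by the pieces of [W], where
    [a'] and [m'] take their values. The resulting map is then read in [E], so that later arguments
    never mention the subtype. *)
Lemma sym_lift (E : lmodType F) (W : graded_subspace E) (mul : E -> E -> E) (one : E)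
    (a' : A -> E) (m' : M -> E) :
  is_graded_alg W mul one ->
  linear a' -> (forall i f, homog i f -> W i (a' f)) ->
  linear m' -> (forall i x, homog i x -> W i (m' x)) ->
  a' (csa_one A) = one ->
  (forall f h, a' (csa_mul f h) = mul (a' f) (a' h)) ->
  (forall f x, m' (act f x) = mul (a' f) (m' x)) ->
  exists h : S -> E,
    [/\ linear h, forall i x, homog i x -> W i (h x), h (csa_one S) = one,
        forall x y, h (csa_mul x y) = mul (h x) (h y)
      & h \o a =1 a' /\ h \o m =1 m'].
Proof.
move=> GA al ah ml mh a1 aM mM.
have spanI (U : superspace F) (f : U -> E) : linear f ->
    (forall i u, homog i u -> W i (f u)) -> forall u, f u \in in_span W.
  move=> fl fh u; have [u0 [u1 [h0 h1 ->]]] := homog_decomp u.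
  by rewrite (linearP_D fl) rpredD //; apply: piece_span; apply: fh; eassumption.
pose a'' f : span_csa GA := Span (spanI A a' al ah f).
pose m'' x : span_csa GA := Span (spanI M m' ml mh x).
have pr : is_sym_pair act a'' m''.
  split; [split; [split| |]|split|] => *; try apply: val_inj; rewrite //=.
  - by move=> c f h; apply: val_inj; apply: al.
  - exact: (ah).
  - by move=> c x y; apply: val_inj; apply: ml.
  - exact: (mh).
have [h [[[hl hh] h1 hM] ha hm _]] := symS.2 _ _ _ pr.
exists (fun x => span_val (h x)); split.
- by move=> c x y; rewrite hl.
- by move=> i x /hh.
- by rewrite h1.
- by move=> x y; rewrite hM.
- by split=> x /=; [have /= -> := ha x | have /= -> := hm x].
Qed.

Lemma sym_endo_id (h : S -> S) : is_csa_hom h -> h \o a =1 a -> h \o m =1 m -> h =1 id.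
Proof.
move=> hh ha hm; have [k [_ _ _ u]] := symS.2 _ _ _ symS.1.
by move=> x; rewrite (u h) // -(u id).
Qed.

(** The universal property implies that [S] is generated by the images of [A] and [M]: the
    homogeneous elements satisfying [P] span a subalgebra, and the lift of the canonical maps into
    it, followed by the inclusion, fixes the generators and hence is the identity. *)
Lemma sym_ind (P : bool -> S -> Prop) :
  (forall i c x y, P i x -> P i y -> P i (c *: x + y)) ->
  (forall i f, homog i f -> P i (a f)) ->
  (forall i x, homog i x -> P i (m x)) ->
  (forall i j x y, homog i x -> homog j y -> P i x -> P j y ->
     P (i (+) j) (csa_mul x y)) ->
  forall i x, homog i x -> P i x.
Proof.
move=> Pl Pa Pm PM.
have [[[al ah] a1 aM] [ml mh] mM] := symS.1.
have P0 i : P i 0 by rewrite -(linearP_0 al); apply: Pa; apply: homog0.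
pose W := @GradedSubspace F S (fun i x => homog i x /\ P i x)
  (fun i => conj (homog0 S i) (P0 i))
  (fun i c x y hx hy => conj (homog_lin c hx.1 hy.1) (Pl i c x y hx.2 hy.2))
  (fun x h0 h1 => homog_disjoint h0.1 h1.1).
have [bl br bh] := @csa_bilinear F S.
have GA : is_graded_alg W (@csa_mul F S) (csa_one S).
  split=> //.
  - by move=> i j x y [hx px] [hy py]; split; [apply: bh | apply: PM].
  - by move=> *; apply: csa_mulA.
  - by split; [apply: csa_one_even | rewrite -a1; apply: Pa; apply: csa_one_even].
  - by move=> *; apply: csa_mul1.
  - by move=> i j x y [hx _] [hy _]; apply: csa_mulC.
have [|i x hx||i x hx||||h [hl hh h1 hM [ha hm]]] := sym_lift (a' := a) (m' := m) GA => //.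
- by split; [apply: ah | apply: Pa].
- by split; [apply: mh | apply: Pm].
move=> i x hx; have [_] := hh _ _ hx.
rewrite (sym_endo_id _ ha hm) //; split=> //; split=> // j y hy.
by have [] := hh _ _ hy.
Qed.

End SymmetricSuperalgebra.

(** * The bicommutant of a supercommuting family of operators *)

Section Operators.
Variables (F : fieldType) (V : superspace F).
Implicit Types (T P Q : V -> V) (i j k : bool).

(** Linearity is included because [V -> V] contains all functions. *)
Definition op_homog i T : Prop :=
  linear T /\ forall j v, homog j v -> homog (i (+) j) (T v).

Lemma op_add P Q v : (P + Q) v = P v + Q v. Proof. by []. Qed.
Lemma op_scale c P v : (c *: P) v = c *: P v. Proof. by []. Qed.
Definition opE := (op_add, op_scale).

Lemma op_homog0 i : op_homog i 0.
Proof.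
split=> [c u v|j v _]; last exact: homog0.
by rewrite -[RHS]/(c *: 0 + 0) scaler0 addr0.
Qed.

Lemma op_homog_lin i c P Q : op_homog i P -> op_homog i Q -> op_homog i (c *: P + Q).
Proof.
case=> Pl Ph [Ql Qh]; split=> [d u v|j v hv]; rewrite !opE.
  by rewrite Pl Ql; module F.
by apply: homog_lin; [apply: Ph | apply: Qh].
Qed.

Lemma op_homog_comp i j P Q : op_homog i P -> op_homog j Q -> op_homog (i (+) j) (P \o Q).
Proof.
case=> Pl Ph [Ql Qh]; split=> [d u v|k v hv] /=; first by rewrite Ql Pl.
by rewrite -addbA; apply: Ph; apply: Qh.
Qed.

Lemma op_homog_disjoint P : op_homog false P -> op_homog true P -> P = 0.
Proof.
case=> Pl P0 [_ P1]; apply/funext => v.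
have [v0 [v1 [h0 h1 ->]]] := homog_decomp v.
rewrite (linearP_D Pl) -[RHS]/(0 : V).
rewrite (homog_disjoint (P0 _ _ h0) (P1 _ _ h0)) add0r.
exact: homog_disjoint (P1 _ _ h1) (P0 _ _ h1).
Qed.

Definition commutant (K : bool -> (V -> V) -> Prop) j Q : Prop :=
  op_homog j Q /\ forall i P v, K i P -> scomm i j P Q v = 0.

Lemma scommC i j P Q v : scomm i j P Q v = 0 -> scomm j i Q P v = 0.
Proof.
move=> /(congr1 (fun w => - ((-1) ^+ (i && j) *: w))); rewrite scaler0 oppr0 => <-.
by rewrite /scomm; case: i; case: j; rewrite /=; module F.
Qed.

Lemma commutant_lin K j c P Q :
  commutant K j P -> commutant K j Q ->
  (forall i T, K i T -> linear T) -> commutant K j (c *: P + Q).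
Proof.
move=> [Ph Pc] [Qh Qc] Kl; split; first exact: op_homog_lin.
move=> i T v KT; rewrite /scomm !opE !(linearPE (Kl _ _ KT)).
have /subr0_eq -> := Pc i T v KT; have /subr0_eq -> := Qc i T v KT.
module F.
Qed.

Lemma commutant_comp K j k P Q :
  commutant K j P -> commutant K k Q -> commutant K (j (+) k) (P \o Q).
Proof.
move=> [Ph Pc] [Qh Qc]; split; first exact: op_homog_comp.
move=> i T v KT; rewrite /scomm /=.
have /subr0_eq -> := Pc i T (Q v) KT; have /subr0_eq := Qc i T v KT => /= ->.
rewrite (linearP_Z Ph.1).
by case: i KT; case: j {Ph Pc}; case: k {Qh Qc}; rewrite /= => KT; module F.
Qed.

Lemma commutant0 K j : (forall i T, K i T -> linear T) -> commutant K j 0.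
Proof.
move=> Kl; split; first exact: op_homog0.
by move=> i T v KT; rewrite /scomm -[(0 : V -> V) _]/(0 : V) (linearP_0 (Kl _ _ KT)) scaler0 subr0.
Qed.

End Operators.

(** * Modules over the symmetric superalgebra from supercommuting actions *)

Section SymmetricModule.
Variables (F : fieldType) (A : comSuperalgebra F) (M : superspace F).
Variables (act : A -> M -> M) (S : comSuperalgebra F) (a : A -> S) (m : M -> S).
Hypothesis symS : is_sym_superalgebra act a m.
Variables (V : superspace F) (aV : A -> V -> V) (mV : M -> V -> V).

Definition act_op i (T : V -> V) : Prop :=
  (exists2 f, homog i f & T = aV f) \/ (exists2 x, homog i x & T = mV x).

Hypotheses (aVP : is_csa_module aV) (mVB : even_bilinear mV).
Hypothesis mV_act : forall f x v, mV (act f x) v = aV f (mV x v).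
Hypothesis aV_mV : forall i j f x v, homog i f -> homog j x -> scomm i j (aV f) (mV x) v = 0.
Hypothesis mV_mV : forall i j x y v, homog i x -> homog j y -> scomm i j (mV x) (mV y) v = 0.

Lemma aV_aV i j f h v : homog i f -> homog j h -> scomm i j (aV f) (aV h) v = 0.
Proof.
have [[al _ _] _ aM] := aVP.
by move=> hf hh; rewrite /scomm -!aM (csa_mulC hf hh) (linearP_Z (al v)) subrr.
Qed.

Lemma act_op_homog i T : act_op i T -> op_homog i T.
Proof.
have [[al ar ah] _ _] := aVP; have [ml mr mh] := mVB.
by case=> [[f hf ->]|[x hx ->]]; split=> // j v; [apply: ah | apply: mh].
Qed.

Lemma act_op_commutant i T : act_op i T -> commutant act_op i T.
Proof.
move=> hT; split; first exact: act_op_homog.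
case: hT => [[f hf ->]|[x hx ->]] j P v [[f' hf' ->]|[x' hx' ->]].
- exact: aV_aV.
- by apply: scommC; apply: aV_mV.
- exact: aV_mV.
- exact: mV_mV.
Qed.

(** Membership in both commutants makes any two elements supercommute at once: one lies in the
    commutant of the action operators, the other supercommutes with that whole commutant. *)
Definition bicommutant i T : Prop :=
  commutant act_op i T /\ commutant (commutant act_op) i T.

Lemma act_op_bicommutant i T : act_op i T -> bicommutant i T.
Proof.
move=> hT; split; first exact: act_op_commutant.
split; first exact: act_op_homog.
by move=> j P v [_ hP]; apply: scommC; apply: hP.
Qed.

Lemma act_op_lin i T : act_op i T -> linear T.
Proof. by case/act_op_homog. Qed.

Lemma commutant_linear (K : bool -> (V -> V) -> Prop) i T : commutant K i T -> linear T.
Proof. by case=> -[]. Qed.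

Lemma bicommutant0 i : bicommutant i 0.
Proof.
by split; apply: commutant0; [apply: act_op_lin | apply: commutant_linear].
Qed.

Lemma bicommutant_lin i c P Q :
  bicommutant i P -> bicommutant i Q -> bicommutant i (c *: P + Q).
Proof.
move=> [hP kP] [hQ kQ].
by split; apply: commutant_lin => //; [apply: act_op_lin | apply: commutant_linear].
Qed.

Lemma bicommutant_disjoint P : bicommutant false P -> bicommutant true P -> P = 0.
Proof. by move=> [[h0 _] _] [[h1 _] _]; apply: op_homog_disjoint. Qed.

Definition bicommutant_space : graded_subspace (V -> V) :=
  GradedSubspace bicommutant0 bicommutant_lin bicommutant_disjoint.

Lemma bicommutant_alg : is_graded_alg bicommutant_space (fun P Q => P \o Q) id.
Proof.
split.
- by [].
- move=> i P [[[Pl _] _] _] c Q R; apply/funext => v.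
  by rewrite /= !opE Pl.
- move=> i j P Q [hP kP] [hQ kQ].
  by split; apply: commutant_comp.
- by [].
- have id_comm (K : bool -> (V -> V) -> Prop) : commutant K false id.
    by split=> // i T v _; rewrite /scomm andbF /=; module F.
  by split; apply: id_comm.
- by [].
- move=> i j P Q [hP kP] [hQ kQ]; apply/funext => v.
  by apply/eqP; rewrite -subr_eq0; apply/eqP; apply: (kQ.2 _ _ v hP).
Qed.

Lemma sym_module_ext : exists iota : S -> V -> V,
  [/\ is_csa_module iota, forall f v, iota (a f) v = aV f v
    & forall x v, iota (m x) v = mV x v].
Proof.
have [[al ar ah] a1 aM] := aVP; have [ml mr mh] := mVB.
have [|i f hf||i x hx||||h [hl hh h1 hM [ha hm]]] :=
    sym_lift symS (a' := aV) (m' := mV) bicommutant_alg.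
- by move=> c f f'; apply/funext => v; apply: al.
- by apply: act_op_bicommutant; left; exists f.
- by move=> c x x'; apply/funext => v; apply: ml.
- by apply: act_op_bicommutant; right; exists x.
- by apply/funext.
- by move=> f f'; apply/funext => v; apply: aM.
- by move=> f x; apply/funext => v; apply: mV_act.
exists h; split=> [|f v|x v].
- split; last by move=> x y v; rewrite hM.
    split; first by move=> v c x y; rewrite hl.
      (* The value of [h] at an inhomogeneous element is a priori only a function; it is linear as
         the sum of two homogeneous operators. *)
      move=> x; have [x0 [x1 [h0 h1' ->]]] := homog_decomp x.
      have [[[l0 _] _] _] := hh _ _ h0; have [[[l1 _] _] _] := hh _ _ h1'.
      by move=> c u v; rewrite (linearP_D hl) !opE l0 l1; module F.
    by move=> i j x v /hh [[[_ H] _] _]; apply: H.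
  by move=> v; rewrite h1.
- by have /= -> := ha f.
- by have /= -> := hm x.
Qed.

End SymmetricModule.

(** * Gerstenhaber algebras *)

(** The difference $x_0-y_0=y_1-x_1$ is both even and odd. *)
Lemma homog_decomp_unique (F : fieldType) (V : superspace F) (x0 x1 y0 y1 : V) :
  homog false x0 -> homog true x1 -> homog false y0 -> homog true y1 ->
  x0 + x1 = y0 + y1 -> x0 = y0 /\ x1 = y1.
Proof.
move=> hx0 hx1 hy0 hy1 e.
have e' : -1 *: y0 + x0 = -1 *: x1 + y1.
  have /(congr1 (fun w => w - x1 - y0)) := e; rewrite addrK => ex0.
  by rewrite scaleN1r addrC ex0; module F.
have h0 := homog_lin (-1) hy0 hx0; have h1 := homog_lin (-1) hx1 hy1.
rewrite -e' in h1; have z := homog_disjoint h0 h1.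
move: z (z); rewrite {1}e' !scaleN1r ![- _ + _]addrC.
by move=> /subr0_eq -> /subr0_eq ->.
Qed.

(** Homogeneous components are only known to exist, so they are picked by choice; their uniqueness
    makes the map linear. It gives a meaning to the sign $(-1)^{p(Y)}$ for inhomogeneous $Y$. *)
Lemma parity_involution (F : fieldType) (V : superspace F) :
  exists2 s : V -> V, linear s & forall i x, homog i x -> s x = (-1) ^+ i *: x.
Proof.
have /choice [s sP] : forall x : V, exists y : V, exists x0 x1,
    [/\ homog false x0, homog true x1, x = x0 + x1 & y = x0 - x1].
  by move=> x; have [x0 [x1 [h0 h1 e]]] := homog_decomp x; exists (x0 - x1), x0, x1.
exists s => [c x y|i x hx].
  have [x0 [x1 [hx0 hx1 ex ->]]] := sP x; have [y0 [y1 [hy0 hy1 ey ->]]] := sP y.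
  have [z0 [z1 [hz0 hz1 ez ->]]] := sP (c *: x + y).
  have [|-> ->] := homog_decomp_unique hz0 hz1 (homog_lin c hx0 hy0) (homog_lin c hx1 hy1).
    by rewrite -ez {1}ex {1}ey; module F.
  module F.
have [x0 [x1 [hx0 hx1 ex ->]]] := sP x; have x_0 := homog0 V.
case: i hx => hx.
  have [|-> ->] := homog_decomp_unique hx0 hx1 (x_0 false) hx; first by rewrite -ex add0r.
  rewrite /=; module F.
have [|-> ->] := homog_decomp_unique hx0 hx1 hx (x_0 true); first by rewrite -ex addr0.
rewrite /=; module F.
Qed.

Section Gerstenhaber.
Variables (F : fieldType) (G : gerstenhaber F).
Implicit Types X Y Z : G.

Lemma gerst_linl Y : linear (fun X : G => (gerst_bracket X Y)).
Proof. by have [[l _ _] _ _] := @gerst_is_lie F G; apply: l. Qed.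

Lemma gerst_linr X : linear (fun Y : G => (gerst_bracket X Y)).
Proof. by have [[_ r _] _ _] := @gerst_is_lie F G; apply: r. Qed.

Lemma Pi_homog (V : superspace F) i (x : V) : homog i x -> homog (~~ i) (x : Pi V).
Proof. by rewrite -{1}(negbK i). Qed.

Lemma gerst_homog i j X Y : homog i X -> homog j Y -> homog (~~ (i (+) j)) (gerst_bracket X Y).
Proof.
have [[_ _ h] _ _] := @gerst_is_lie F G.
move=> /Pi_homog hX /Pi_homog hY; have /= := h _ _ _ _ hX hY.
by case: i {hX}; case: j {hY}.
Qed.

Lemma gerst_skew i j X Y : homog i X -> homog j Y ->
  gerst_bracket X Y = - ((-1) ^+ (~~ i && ~~ j) *: gerst_bracket Y X).
Proof.
have [_ sk _] := @gerst_is_lie F G.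
by move=> /Pi_homog hX /Pi_homog hY; apply: sk.
Qed.

Lemma gerst_jacobi i j X Y Z : homog i X -> homog j Y ->
  gerst_bracket X (gerst_bracket Y Z) = gerst_bracket (gerst_bracket X Y) Z
    + (-1) ^+ (~~ i && ~~ j) *: gerst_bracket Y (gerst_bracket X Z).
Proof.
have [_ _ ja] := @gerst_is_lie F G.
by move=> /Pi_homog hX /Pi_homog hY; apply: ja.
Qed.

Lemma csa_linl (B : comSuperalgebra F) (y : B) : linear (fun x : B => csa_mul x y).
Proof. by have [l _ _] := @csa_bilinear F B; apply: l. Qed.

Lemma csa_linr (B : comSuperalgebra F) (x : B) : linear (csa_mul x).
Proof. by have [_ r _] := @csa_bilinear F B; apply: r. Qed.

Lemma csa_homog (B : comSuperalgebra F) i j (x y : B) :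
  homog i x -> homog j y -> homog (i (+) j) (csa_mul x y).
Proof. by have [_ _ h] := @csa_bilinear F B; apply: h. Qed.

(** Skewcommutativity carries the Leibniz rule from the second argument to the first. *)
Lemma gerst_leibniz_left i j k X Y Z : homog i X -> homog j Y -> homog k Z ->
  gerst_bracket (csa_mul X Y) Z =
    csa_mul X (gerst_bracket Y Z) + (-1) ^+ (j && ~~ k) *: csa_mul (gerst_bracket X Z) Y.
Proof.
move=> hX hY hZ.
rewrite (gerst_skew (csa_homog hX hY) hZ) (gerst_leibniz _ hZ hX).
rewrite (gerst_skew hX hZ) (gerst_skew hY hZ).
rewrite !(linearPE (csa_linl _)) !(linearPE (csa_linr _)).
by case: i {hX}; case: j {hY}; case: k {hZ}; rewrite /=; module F.
Qed.

(** For homogeneous $Y$, the Leibniz rule on $1=1\cdot 1$ gives $[Y,1]=2[Y,1]$. *)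
Lemma gerst_one X : gerst_bracket X (csa_one G) = 0.
Proof.
have homog_one i Y : homog i Y -> gerst_bracket Y (csa_one G) = 0.
  move=> hY; have h1 := csa_one_even G; have hB := gerst_homog hY h1.
  have := gerst_leibniz (csa_one G) hY h1; rewrite andbF !csa_mul1 scale1r.
  rewrite (csa_mulC hB h1) andbF scale1r csa_mul1.
  by move=> /(congr1 (fun w => w - gerst_bracket Y (csa_one G))); rewrite addrK subrr.
have [X0 [X1 [h0 h1 ->]]] := homog_decomp X.
by rewrite (linearP_D (gerst_linl _)) (homog_one _ _ h0) (homog_one _ _ h1) addr0.
Qed.

End Gerstenhaber.

Lemma homog_ext (F : fieldType) (U : superspace F) (E : lmodType F) (f g : U -> E) :
  linear f -> linear g -> (forall i u, homog i u -> f u = g u) -> f =1 g.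
Proof.
move=> fl gl e u; have [u0 [u1 [h0 h1 ->]]] := homog_decomp u.
by rewrite (linearP_D fl) (linearP_D gl) (e _ _ h0) (e _ _ h1).
Qed.

(** * The algebra of Leibniz pairs *)

Section LeibnizPairs.
Variables (F : fieldType) (eps : F) (G : gerstenhaber F) (V : superspace F).
Variables (iota : G -> V -> V) (s : G -> G).
Hypotheses (iotaP : is_csa_module iota) (sL : linear s).
Hypothesis sP : forall i X, homog i X -> s X = (-1) ^+ i *: X.
Implicit Types (i j k : bool) (X Y Z : G).

Lemma iota_linl v : linear (iota^~ v).
Proof. by have [[l _ _] _ _] := iotaP; apply: l. Qed.

Lemma iota_linr X : linear (iota X).
Proof. by have [[_ r _] _ _] := iotaP; apply: r. Qed.

Lemma iota_mul X Y v : iota (csa_mul X Y) v = iota X (iota Y v).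
Proof. by have [_ _ h] := iotaP; apply: h. Qed.

Lemma iota_homog i X : homog i X -> op_homog i (iota X).
Proof. by have [[_ r h] _ _] := iotaP; split=> // j v; apply: h. Qed.

Lemma iotaC i j X Y v : homog i X -> homog j Y ->
  iota X (iota Y v) = (-1) ^+ (i && j) *: iota Y (iota X v).
Proof.
by move=> hX hY; rewrite -!iota_mul (csa_mulC hX hY) (linearP_Z (iota_linl _)).
Qed.

Definition lie_derivation i X (T : V -> V) : Prop :=
  forall j Y v, homog j Y -> scomm (~~ i) j T (iota Y) v = iota (gerst_bracket X Y) v.

Lemma lie_derivationE i j X T Y v : lie_derivation i X T -> homog j Y ->
  T (iota Y v) = (-1) ^+ (~~ i && j) *: iota Y (T v) + iota (gerst_bracket X Y) v.
Proof. by move=> h hY; rewrite -(h j) // /scomm addrC subrK. Qed.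

(** The pair has the parity of its first component. The operator stands for $L_X$ and has the
    opposite parity, because $L$ is even on $\Pi\mathcal G$. *)
Definition leibniz_pair i (p : G * (V -> V)) : Prop :=
  [/\ homog i p.1, op_homog (~~ i) p.2 & lie_derivation i p.1 p.2].

(** The sign $(-1)^{p(Y)}$ enters through the parity involution [s], so that the product is defined
    on all pairs. *)
Definition leibniz_mul (p q : G * (V -> V)) : G * (V -> V) :=
  (csa_mul p.1 q.1,
   fun v => iota p.1 (q.2 v) + p.2 (iota (s q.1) v)
     - eps *: iota (gerst_bracket p.1 (s q.1)) v).

Lemma leibniz_pair0 i : leibniz_pair i 0.
Proof.
split; [exact: homog0 | exact: op_homog0 |].
move=> j Y v _; rewrite (linearP_0 (gerst_linl _)) (linearP_0 (iota_linl _)).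
rewrite /scomm /= -[(0 : V -> V) _]/(0 : V) -[(0 : V -> V) _]/(0 : V).
by rewrite (linearP_0 (iota_linr _)); module F.
Qed.

Lemma leibniz_pair_lin i c (p q : (G * (V -> V))%type) :
  leibniz_pair i p -> leibniz_pair i q -> leibniz_pair i (c *: p + q).
Proof.
case: p q => X T [Y S] [/= hX hT dT] [/= hY hS dS].
split=> /=; [exact: homog_lin | exact: op_homog_lin |].
move=> j Z v hZ; rewrite gerst_linl iota_linl -(dT j) // -(dS j) //.
by rewrite /scomm !opE !(linearPE (iota_linr _)); module F.
Qed.

Lemma leibniz_pair_disjoint p : leibniz_pair false p -> leibniz_pair true p -> p = 0.
Proof.
case: p => X T [/= X0 T0 _] [/= X1 T1 _].
by rewrite (homog_disjoint X0 X1) (op_homog_disjoint T1 T0).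
Qed.

Definition leibniz_pairs : graded_subspace (G * (V -> V))%type :=
  GradedSubspace leibniz_pair0 leibniz_pair_lin leibniz_pair_disjoint.

Lemma leibniz_mul_linl q : linear (leibniz_mul^~ q).
Proof.
move=> c [X T] [X' T']; congr (_, _) => /=; first exact: csa_linl.
apply/funext => v; rewrite !opE gerst_linl !iota_linl.
module F.
Qed.

Lemma leibniz_mul_linr i p : leibniz_pair i p -> linear (leibniz_mul p).
Proof.
case: p => X T [/= hX [Tl _] _] c [Y S] [Y' S']; congr (_, _) => /=; first exact: csa_linr.
apply/funext => v; rewrite !opE sL gerst_linr !iota_linl iota_linr Tl.
module F.
Qed.

(** In the commutator with $\iota_Z$, the terms with $T$ and $S$ produce $[X,Z]\wedge Y$ and
    $X\wedge[Y,Z]$, which add up to $[X\wedge Y,Z]$ by the left Leibniz rule; the $\epsilon$-term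
    supercommutes with $\iota_Z$. *)
Lemma leibniz_mul_pair i j p q :
  leibniz_pair i p -> leibniz_pair j q -> leibniz_pair (i (+) j) (leibniz_mul p q).
Proof.
case: p q => X T [Y S] [/= hX [Tl Th] dT] [/= hY [Sl Sh] dS].
split=> /=; first exact: csa_homog.
  split=> [c u v|k v hv].
    by rewrite Sl !iota_linr Tl; module F.
  have hB := gerst_homog hX hY.
  rewrite (sP hY) !(linearPE (gerst_linr _)) !(linearPE (iota_linl _)).
  rewrite (linearP_Z Tl) -scalerN.
  have h1 : homog (~~ (i (+) j) (+) k) (iota X (S v)).
    by have := (iota_homog hX).2 _ _ (Sh _ _ hv); case: (i); case: (j); case: (k).
  have h2 : homog (~~ (i (+) j) (+) k) (T (iota Y v)).
    by have := Th _ _ ((iota_homog hY).2 _ _ hv); case: (i); case: (j); case: (k).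
  have h3 := (iota_homog hB).2 _ _ hv.
  by rewrite -scaleN1r; do !(apply: homogD || apply: homogZ).
move=> k Z v hZ; rewrite /scomm (sP hY) !(linearPE (gerst_linr _)) !(linearPE (iota_linl _)).
rewrite !(linearPE Tl).
rewrite (iotaC v hY hZ) (linearP_Z Tl) (lie_derivationE _ dT hZ) (lie_derivationE v dS hZ).
rewrite (iotaC _ (gerst_homog hX hY) hZ) (gerst_leibniz_left hX hY hZ).
rewrite !(linearPE (iota_linl _)) !(linearPE (iota_linr _)) !iota_mul.
rewrite (iotaC _ hX hZ).
by case: i hX dT Th; case: j hY dS Sh; case: k hZ => *; rewrite /=; module F.
Qed.

(** The operator terms match by multiplicativity of $\iota$. The $\epsilon$-terms match by the
    cocycle identity for the bracket, which follows from the Leibniz rules in its two arguments. *)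
Lemma leibniz_mulA i j k p q r :
  leibniz_pair i p -> leibniz_pair j q -> leibniz_pair k r ->
  leibniz_mul p (leibniz_mul q r) = leibniz_mul (leibniz_mul p q) r.
Proof.
case: p q r => X T [Y S] [Z R] [/= hX [Tl _] _] [/= hY _ _] [/= hZ _ _].
congr (_, _) => /=; first exact: csa_mulA.
apply/funext => v.
rewrite (sP hY) (sP hZ) (sP (csa_homog hY hZ)).
rewrite !(linearPE (gerst_linr _)) !(linearPE (iota_linl _)) !(linearPE (iota_linr _)).
rewrite !(linearPE Tl) !iota_mul.
rewrite (gerst_leibniz_left hX hY hZ) (gerst_leibniz Z hX hY).
rewrite (csa_mulC (gerst_homog hX hZ) hY).
rewrite !(linearPE (iota_linl _)) !iota_mul.
by case: i hX; case: j hY; case: k hZ => *; rewrite /=; module F.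
Qed.

(** Moving $T$ past $\iota_Y$ turns the product into
    $\iota_XS+(-1)^{p(X)p(Y)}\iota_YT+(1-\epsilon)(-1)^{p(Y)}\iota_{[X,Y]}$, which is supersymmetric
    because $(-1)^{p(Y)}[X,Y]$ is. *)
Lemma leibniz_mulC i j p q : leibniz_pair i p -> leibniz_pair j q ->
  leibniz_mul p q = (-1) ^+ (i && j) *: leibniz_mul q p.
Proof.
case: p q => X T [Y S] [/= hX [Tl _] dT] [/= hY [Sl _] dS].
congr (_, _) => /=; first exact: csa_mulC.
apply/funext => v; rewrite opE (sP hX) (sP hY).
rewrite !(linearPE (gerst_linr _)) !(linearPE (iota_linl _)).
rewrite (linearPE Tl) (linearPE Sl).
rewrite (lie_derivationE _ dT hY) (lie_derivationE _ dS hX) (gerst_skew hX hY).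
rewrite !(linearPE (iota_linl _)).
by case: i hX {dT}; case: j hY {dS} => *; rewrite /=; module F.
Qed.

(** The zero operator is a valid partner of $1$ because $[1,Y]=0$; the unit thus encodes $L_1=0$. *)
Lemma leibniz_pairs_alg : is_graded_alg leibniz_pairs leibniz_mul (csa_one G, 0).
Proof.
have one_iota v : iota (csa_one G) v = v by have [_ h _] := iotaP; apply: h.
split.
- exact: leibniz_mul_linl.
- exact: leibniz_mul_linr.
- exact: leibniz_mul_pair.
- exact: leibniz_mulA.
- split; [exact: csa_one_even | exact: op_homog0 |].
  move=> j Y v hY; rewrite (gerst_skew (csa_one_even G) hY) gerst_one.
  have [_ _] := leibniz_pair0 false => /(_ j Y v hY).
  by rewrite (linearP_0 (gerst_linl _)) scaler0 oppr0.
- move=> j [Y S] [/= hY _ _]; congr (_, _) => /=; first exact: csa_mul1.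
  apply/funext => v; rewrite (sP hY) (linearPE (gerst_linr _)).
  rewrite (gerst_skew (csa_one_even G) hY) gerst_one one_iota.
  rewrite !(scaler0, oppr0) (linearP_0 (iota_linl _)) -[(0 : V -> V) _]/(0 : V).
  module F.
- exact: leibniz_mulC.
Qed.

End LeibnizPairs.

(** * Construction of $L$ by lifting to Leibniz pairs *)

Section LieOperator.
Variables (F : fieldType) (eps : F) (A : comSuperalgebra F) (M : superspace F).
Variables (act : A -> M -> M) (G : gerstenhaber F) (a : A -> G) (m : M -> G).
Hypothesis symG : is_sym_superalgebra act a m.
Hypotheses (act_linl : forall x, linear (act^~ x)) (act_linr : forall f, linear (act f)).
Variables (V : superspace F) (iota : G -> V -> V).
Hypothesis iotaP : is_csa_module iota.

(** Both $[T,\iota_Y]$ and $\iota_{[X,Y]}$ obey the same Leibniz rule in $Y$, so generators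
    suffice. *)
Lemma lie_derivation_gen i X T : homog i X -> op_homog (~~ i) T ->
  (forall j f v, homog j f ->
     scomm (~~ i) j T (iota (a f)) v = iota (gerst_bracket X (a f)) v) ->
  (forall j x v, homog j x ->
     scomm (~~ i) j T (iota (m x)) v = iota (gerst_bracket X (m x)) v) ->
  lie_derivation iota i X T.
Proof.
move=> hX [Tl Th] ha hm j Y v hY; move: v.
pose P j Y := forall v, scomm (~~ i) j T (iota Y) v = iota (gerst_bracket X Y) v.
apply: (sym_ind symG (P := P)) hY => {j Y}.
- move=> j c Y Z hY hZ v; rewrite gerst_linr (iota_linl iotaP) -hY -hZ.
  by rewrite /scomm !(iota_linl iotaP) !(linearPE Tl); module F.
- by move=> j f hf v; apply: ha.
- by move=> j x hx v; apply: hm.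
move=> j k Y Z hY hZ eY eZ v; rewrite (gerst_leibniz _ hX hY).
rewrite !(linearPE (iota_linl iotaP _)) /scomm !(iota_mul iotaP) -eY -eZ /scomm.
rewrite !(linearPE (iota_linr iotaP _)).
by case: i {hX Th ha hm P eY eZ}; case: j {hY}; case: k {hZ}; rewrite /=; module F.
Qed.

Variables (aL : A -> V -> V) (mL : M -> V -> V).
Hypotheses (aL_lin : forall v, linear (aL^~ v)) (mL_lin : forall v, linear (mL^~ v)).
Hypothesis aL_homog : forall i f, homog i f -> op_homog (~~ i) (aL f).
Hypothesis mL_homog : forall i x, homog i x -> op_homog (~~ i) (mL x).
Hypothesis aL_der : forall i f, homog i f -> lie_derivation iota i (a f) (aL f).
Hypothesis mL_der : forall i x, homog i x -> lie_derivation iota i (m x) (mL x).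
Hypothesis aL_mul : forall i j f h v, homog i f -> homog j h ->
  aL (csa_mul f h) v = iota (a f) (aL h v) + (-1) ^+ j *: aL f (iota (a h) v)
    - (eps * (-1) ^+ j) *: iota (gerst_bracket (a f) (a h)) v.
Hypothesis mL_act : forall i j f x v, homog i f -> homog j x ->
  mL (act f x) v = iota (a f) (mL x v) + (-1) ^+ j *: aL f (iota (m x) v)
    - (eps * (-1) ^+ j) *: iota (gerst_bracket (a f) (m x)) v.
Hypothesis aL_one : forall v, aL (csa_one A) v = 0.

Lemma lie_operator_ext : exists L : G -> V -> V,
  [/\ forall v, linear (L^~ v),
      forall i X, homog i X -> op_homog (~~ i) (L X) /\ lie_derivation iota i X (L X),
      right_leibniz eps iota (L : gerst_lie G -> V -> V)
    & (forall f v, L (a f) v = aL f v) /\ (forall x v, L (m x) v = mL x v)].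
Proof.
have [s sL sP] := parity_involution G.
have GA := leibniz_pairs_alg eps iotaP sL sP.
have [[[al ah] a1 aM] [ml mh] mM] := symG.1.
pose a' f : G * (V -> V) := (a f, aL f); pose m' x : G * (V -> V) := (m x, mL x).
have aLl c f h : aL (c *: f + h) = c *: aL f + aL h.
  by apply/funext => v; apply: aL_lin.
have mLl c x y : mL (c *: x + y) = c *: mL x + mL y.
  by apply/funext => v; apply: mL_lin.
have a'l : linear a' by move=> c f h; congr (_, _); [apply: al | apply: aLl].
have m'l : linear m' by move=> c f h; congr (_, _); [apply: ml | apply: mLl].
have a'h i f : homog i f -> leibniz_pair iota i (a' f).
  by move=> hf; split; [apply: ah | apply: aL_homog | apply: aL_der].
have m'h i x : homog i x -> leibniz_pair iota i (m' x).
  by move=> hx; split; [apply: mh | apply: mL_homog | apply: mL_der].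
(* Right linearity is available for homogeneous pairs only, so [f] is split into its components. *)
have a'lr f : linear (leibniz_mul eps iota s (a' f)).
  have [f0 [f1 [h0 h1 ->]]] := homog_decomp f.
  move=> c p q; rewrite (linearP_D a'l) !(linearP_D (leibniz_mul_linl eps s iotaP _)).
  rewrite (leibniz_mul_linr eps iotaP sL (a'h _ _ h0)).
  rewrite (leibniz_mul_linr eps iotaP sL (a'h _ _ h1)).
  module F.
(* Both sides are linear in each argument, which reduces the identity to homogeneous elements, where
   it is the right Leibniz rule assumed on generators. *)
have a'M f h : a' (csa_mul f h) = leibniz_mul eps iota s (a' f) (a' h).
  move: f; apply: homog_ext => [c x y|c x y|i f hf].
  - by rewrite csa_linl a'l.
  - by rewrite a'l (leibniz_mul_linl eps s iotaP).
  move: h; apply: homog_ext => [c x y|c x y|j h hh].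
  - by rewrite csa_linr a'l.
  - by rewrite a'l a'lr.
  congr (_, _) => /=; first exact: aM.
  have [aLl' _] := aL_homog hf.
  apply/funext => v; rewrite (aL_mul _ hf hh) (sP _ _ (ah _ _ hh)).
  rewrite (linearPE (gerst_linr _)) !(linearPE (iota_linl iotaP _)) (linearPE aLl') /=.
  module F.
have m'M f x : m' (act f x) = leibniz_mul eps iota s (a' f) (m' x).
  move: f; apply: homog_ext => [c f f'|c f f'|i f hf].
  - by rewrite act_linl m'l.
  - by rewrite a'l (leibniz_mul_linl eps s iotaP).
  move: x; apply: homog_ext => [c x y|c x y|j x hx].
  - by rewrite act_linr m'l.
  - by rewrite m'l a'lr.
  congr (_, _) => /=; first exact: mM.
  have [aLl' _] := aL_homog hf.
  apply/funext => v; rewrite (mL_act _ hf hx) (sP _ _ (mh _ _ hx)).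
  rewrite (linearPE (gerst_linr _)) !(linearPE (iota_linl iotaP _)) (linearPE aLl') /=.
  module F.
have [|h [hl hh h1 hM [ha hm]]] := sym_lift symG GA a'l a'h m'l m'h _ a'M m'M.
  by congr (_, _); [exact: a1 | apply/funext => v; apply: aL_one].
(* The first component of the lift is an algebra endomorphism of [G] fixing the generators; hence
   multiplicativity of the lift, read on second components, is the right Leibniz rule. *)
have fst_id X : (h X).1 = X.
  apply: (sym_endo_id symG (h := fun X => (h X).1)).
  - split=> [|//|].
    + split=> [c x y|i x]; first by rewrite hl.
      by case/hh.
    + by rewrite h1.
    + by move=> x y; rewrite hM.
  - by move=> f /=; have /= -> := ha f.
  - by move=> x /=; have /= -> := hm x.
exists (fun X => (h X).2); split.
- by move=> v c X Y; rewrite hl.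
- by move=> i X /hh [_ ? dX]; split=> //; rewrite -{1}[X]fst_id.
- move=> i j X Y v hX hY; have [_ [Xl _] _] := hh _ _ hX.
  rewrite hM /= !fst_id (sP _ _ hY).
  rewrite (linearPE (gerst_linr _)) !(linearPE (iota_linl iotaP _)) (linearPE Xl).
  module F.
- by split=> [f|x] v; [have /= -> := ha f | have /= -> := hm x].
Qed.
End LieOperator.

(** * The Lie module structure *)

Section LieModule.
Variables (F : fieldType) (eps : F) (A : comSuperalgebra F) (M : superspace F).
Variables (act : A -> M -> M) (G : gerstenhaber F) (a : A -> G) (m : M -> G).
Hypothesis symG : is_sym_superalgebra act a m.
Variables (V : superspace F) (iota : G -> V -> V) (L : G -> V -> V).
Hypotheses (iotaP : is_csa_module iota) (L_linl : forall v, linear (L^~ v)).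
Hypothesis L_homog : forall i X, homog i X -> op_homog (~~ i) (L X).
Hypothesis L_der : forall i X, homog i X -> lie_derivation iota i X (L X).
Hypothesis L_mul : right_leibniz eps iota (L : gerst_lie G -> V -> V).

Definition lie_commutes i (X : G) j (Y : G) : Prop :=
  forall v, L (gerst_bracket X Y) v = scomm (~~ i) (~~ j) (L X) (L Y) v.

Lemma lie_commutesC i j X Y : homog i X -> homog j Y ->
  lie_commutes i X j Y -> lie_commutes j Y i X.
Proof.
move=> hX hY h v; rewrite (gerst_skew hY hX) !(linearPE (L_linl _)) h /scomm.
by case: i {hX h}; case: j {hY}; rewrite /=; module F.
Qed.

(** For the inductive step, both sides at $Y\wedge Z$ are expanded by the right Leibniz rule. The
    $\epsilon$-terms are $\iota$ of the three double brackets of $X,Y,Z$ and cancel by the Jacobi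
    identity. *)
Lemma lie_commutes_gen i X : homog i X ->
  (forall j f, homog j f -> lie_commutes i X j (a f)) ->
  (forall j x, homog j x -> lie_commutes i X j (m x)) ->
  forall j Y, homog j Y -> lie_commutes i X j Y.
Proof.
move=> hX ha hm; have [Ll _] := L_homog hX.
apply: (sym_ind symG) => [j c Y Z hY hZ v|||j k Y Z hY hZ eY eZ v].
- rewrite gerst_linr L_linl hY hZ /scomm !L_linl !(linearPE Ll).
  module F.
- exact: ha.
- exact: hm.
have hXY := gerst_homog hX hY; have hXZ := gerst_homog hX hZ.
have [LYl _] := L_homog hY.
rewrite (gerst_leibniz _ hX hY) !(linearPE (L_linl _)).
rewrite (L_mul _ hXY hZ) (L_mul _ hY hXZ) eY eZ /scomm.
rewrite (L_mul v hY hZ) (L_mul (L X v) hY hZ).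
rewrite !(linearPE Ll).
rewrite (lie_derivationE _ (L_der hX) hY) (lie_derivationE v (L_der hX) (gerst_homog hY hZ)).
rewrite (lie_derivationE v (L_der hX) hZ).
rewrite (gerst_jacobi _ hX hY).
rewrite !(linearPE (iota_linl iotaP _)) !(linearPE (iota_linr iotaP _)) !(linearPE LYl).
by case: i {hX ha hm hXY hXZ eY eZ}; case: j {hY}; case: k {hZ}; rewrite /=; module F.
Qed.

(** Reduction to generators in the second argument is used twice, with [lie_commutesC] exchanging
    the arguments in between. *)
Lemma lie_commutes_all :
  (forall i j f h, homog i f -> homog j h -> lie_commutes i (a f) j (a h)) ->
  (forall i j f x, homog i f -> homog j x -> lie_commutes i (a f) j (m x)) ->
  (forall i j x y, homog i x -> homog j y -> lie_commutes i (m x) j (m y)) ->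
  forall i j X Y, homog i X -> homog j Y -> lie_commutes i X j Y.
Proof.
move=> haa ham hmm i j X Y hX hY.
have [[[_ ah] _ _] [_ mh] _] := symG.1.
apply: (lie_commutes_gen hX) hY => {j Y} [j f hf|j x hx].
  have hG := ah _ _ hf; apply: (lie_commutesC hG hX).
  apply: (lie_commutes_gen hG) hX => [k h|k x]; [exact: haa | exact: ham].
have hG := mh _ _ hx; apply: (lie_commutesC hG hX).
apply: (lie_commutes_gen hG) hX => [k h|k y] hk; last exact: hmm.
by apply: (lie_commutesC (ah _ _ hk) hG); apply: ham.
Qed.

Lemma gerst_rep_intro :
  (forall i j X Y, homog i X -> homog j Y -> lie_commutes i X j Y) ->
  is_gerst_rep iota (L : gerst_lie G -> V -> V).
Proof.
move=> hC.
(* Parities in [gerst_lie G] are those of $\Pi\mathcal G$, while the hypotheses on [L] use those of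
   $\mathcal G$. *)
have homogPi i (X : gerst_lie G) : homog i X -> @homog F G (~~ i) X by [].
split=> //.
- split.
  + split.
    * exact: L_linl.
    * move=> X c u v; have [X0 [X1 [h0 h1 ->]]] := @homog_decomp F G X.
      rewrite !(linearP_D (L_linl _)) (L_homog h0).1 (L_homog h1).1.
      module F.
    * move=> i j X v /homogPi hX; have [_ h] := L_homog hX.
      by rewrite -[i]negbK; apply: h.
  + move=> i j X Y v /homogPi hX /homogPi hY.
    by have := hC _ _ _ _ hX hY v; rewrite !negbK.
- by move=> i j X Y v hX hY; rewrite addbT; apply: (L_der hX).
Qed.

End LieModule.

(** Replacing $L_X\iota_Y$ by its reordering plus $\iota_{[X,Y]}$ changes the coefficient of
    $(-1)^{p(Y)}\iota_{[X,Y]}$ from $-\epsilon$ to $1-\epsilon$. *)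
Lemma right_leibniz_equiv (F : fieldType) (eps : F) (G : gerstenhaber F)
    (V : superspace F) (iota : G -> V -> V) (L : gerst_lie G -> V -> V) :
  is_gerst_rep iota L -> right_leibniz eps iota L <-> right_leibniz' eps iota L.
Proof.
move=> [_ _ der]; split=> h i j X Y v hX hY; rewrite (h i j) //.
all: have := der _ _ _ _ v hX hY; rewrite /scomm => /(canRL (subrK _)) ->.
all: by case: i hX; case: j hY => *; rewrite /=; module F.
Qed.

(** * Extension of rigged representations *)

Section RiggedExtension.
Variables (F : fieldType) (g : lieSuperalgebra F) (A : comSuperalgebra F).
Variables (gA : lieSuperalgebroid g A) (eps : F).
Variables (G : gerstenhaber F) (a : A -> G) (m : Pi g -> G).
Hypothesis GS : is_schouten_algebra gA a m.
Variables (V : superspace F).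
Variables (iota0 : Pi (semidirect gA) -> V -> V) (L0 : semidirect gA -> V -> V).
Hypothesis R0 : is_eps_rigged eps iota0 L0.

(** The two parity shifts on [A] in $\Pi(\mathfrak g\ltimes\Pi A)$ cancel. *)
Lemma pair0_homog i (f : A) : homog i f -> @homog F (Pi (semidirect gA)) i (0, f).
Proof. by move=> hf; split; [apply: homog0 | rewrite /= negbK]. Qed.

Lemma pairX_homog i (x : Pi g) : homog i x -> @homog F (Pi (semidirect gA)) i (x, 0).
Proof. by move=> hx; split; [|apply: homog0]. Qed.

Lemma sym_gen_m (x : g) : sym_gen (gA := gA) a m (x, 0) = m x.
Proof. by have [[[al _] _ _] _ _] := GS.1.1; rewrite /sym_gen /= (linearP_0 al) addr0. Qed.

Lemma sym_gen_a (f : A) : sym_gen (gA := gA) a m (0, f) = a f.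
Proof. by have [_ [ml _] _] := GS.1.1; rewrite /sym_gen /= (linearP_0 ml) add0r. Qed.

Lemma rigged_iota_ext : exists iota : G -> V -> V,
  is_csa_module iota /\ forall x v, iota (sym_gen a m x) v = iota0 x v.
Proof.
have [iP [_ [il ir ih] ic _] _ iM _] := R0.
have mVB : even_bilinear (fun (x : Pi g) v => iota0 (x, 0) v).
  split=> [v c x y|x|i j x v hx hv] /=; last exact: (ih _ _ _ _ (pairX_homog hx)).
    by rewrite -il; congr iota0; congr (_, _); rewrite /= scaler0 addr0.
  exact: ir.
have [|||iota [iotaP ia im]] := sym_module_ext GS.1 iP mVB.
- by move=> f x v; apply: iM.
- by move=> i j f x v hf hx; apply: ic; [apply: pair0_homog | apply: pairX_homog].
- by move=> i j x y v hx hy; apply: ic; apply: pairX_homog.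
exists iota; split=> // -[x f] v; rewrite /sym_gen (linearP_D (iota_linl iotaP v)) /= im ia.
rewrite -[X in X + _]scale1r -il; congr iota0; congr (_, _) => /=.
  by rewrite scale1r addr0.
by rewrite scaler0 add0r.
Qed.

Lemma rigged_L_ext (iota : G -> V -> V) : is_csa_module iota ->
  (forall x v, iota (sym_gen a m x) v = iota0 x v) ->
  exists L : gerst_lie G -> V -> V,
  [/\ is_gerst_rep iota L, forall x v, L (sym_gen a m x) v = L0 x v
    & right_leibniz eps iota L].
Proof.
move=> iotaP iE; have [symG brE] := GS.
have [_ [[[Ll Lr Lh] LM] _ _ Li] LMul _ LS] := R0.
have [[[al ah] a1 aM] [ml mh] mM] := symG.1.
have im (x : g) v : iota (m x) v = iota0 (x, 0) v by rewrite -sym_gen_m iE.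
have ia f v : iota (a f) v = iota0 (0, f) v by rewrite -sym_gen_a iE.
have [[sl sr _] _ _] := lad_csa_module gA.
have A0 i (f : A) : homog i f -> i = true -> f = 0.
  by move=> hf e; apply: (lad_even gA); rewrite -e.
have gen_homog i (x : semidirect gA) :
    @homog F (Pi (semidirect gA)) i x -> op_homog (~~ i) (L0 x).
  by move=> hx; split; [apply: Lr | move=> j v hv; apply: Lh].
have gen_der i j (x y : semidirect gA) v : @homog F (Pi (semidirect gA)) i x ->
    @homog F (Pi (semidirect gA)) j y ->
    scomm (~~ i) j (L0 x) (iota (sym_gen a m y)) v =
    iota (gerst_bracket (sym_gen a m x) (sym_gen a m y)) v.
  move=> hx hy; rewrite brE iE -(Li (~~ i) j x y v hx hy).
  by rewrite /scomm !iE.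
have genP i x : @homog F (Pi (semidirect gA)) i x -> homog i (sym_gen (gA := gA) a m x).
  by case: x => x f [/= hx hf]; apply: homogD; [apply: mh | apply: ah; rewrite -[i]negbK].
have der i x : @homog F (Pi (semidirect gA)) i x ->
    lie_derivation iota i (sym_gen (gA := gA) a m x) (L0 x).
  move=> hx; apply: (lie_derivation_gen symG iotaP (genP _ _ hx) (gen_homog _ _ hx)).
    by move=> j f v hf; rewrite -sym_gen_a; apply: (gen_der _ _ _ _ v hx); apply: pair0_homog.
  by move=> j y v hy; rewrite -sym_gen_m; apply: (gen_der _ _ _ _ v hx); apply: pairX_homog.
have [[_ _ _] iota_one _] := iotaP.
have [_ [_ [il ir _] _ _] _ _ _] := R0.
have linearP_iota0 v : linear (fun f : A => iota0 (0, f) v).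
  by move=> c f h; rewrite -il; congr iota0; congr (_, _); rewrite /= scaler0 addr0.
have [[bl br _] _ _] := lie_axioms g; have [[nl nr _] _] := lad_lie_module gA.
(* With $[f,h]=0$ and $[f,X]=-X(f)$, axioms (i) and (iii) become the right Leibniz rule on
   generators. *)
have br_aa f h : gerst_bracket (a f) (a h) = 0.
  rewrite -!sym_gen_a brE /sym_gen /=.
  by rewrite (linearP_0 (br _)) !(linearP_0 (nl _)) subr0 (linearP_0 ml) (linearP_0 al) addr0.
have br_am f x : gerst_bracket (a f) (m x) = - a (lad_anchor gA x f).
  rewrite -sym_gen_a -sym_gen_m brE /sym_gen /=.
  by rewrite (linearP_0 (bl _)) !(linearP_0 (nl _)) sub0r (linearP_0 ml) (linearP_N al) add0r.
have aLl v : linear (fun f : A => L0 (0, f) v).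
  by move=> c f h; rewrite -Ll; congr L0; congr (_, _); rewrite /= scaler0 addr0.
have mLl v : linear (fun x : Pi g => L0 (x, 0) v).
  by move=> c x y; rewrite -Ll; congr L0; congr (_, _); rewrite /= scaler0 addr0.
have [|||||||L [LlG Lhd Lmul [La Lm]]] := @lie_operator_ext F eps A (Pi g) (lad_scale gA) G a m
    symG sl sr V iota iotaP (fun f => L0 (0, f)) (fun x => L0 (x, 0)) aLl mLl.
- by move=> i f hf; apply: gen_homog; apply: pair0_homog.
- by move=> i x hx; apply: gen_homog; apply: pairX_homog.
- by move=> i f hf; rewrite -sym_gen_a; apply: der; apply: pair0_homog.
- by move=> i x hx; rewrite -sym_gen_m; apply: der; apply: pairX_homog.
- move=> i j f h v hf hh; rewrite LMul !ia br_aa (linearP_0 (iota_linl iotaP _)).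
  (* For even [h] this is axiom (i); an odd [h] is zero since [A] is purely even. *)
  case: j hh => hh; last by rewrite /=; module F.
  rewrite (A0 _ _ hh erefl) (linearP_0 (aLl _)) (linearP_0 (linearP_iota0 _)).
  by rewrite (linearP_0 (Lr _)) (linearP_0 (ir _)) /=; module F.
- move=> i j f x v hf hx; rewrite (LS (~~ j)) // ia im br_am (linearPE (iota_linl iotaP _)) ia.
  (* Here [j] is the parity in $\Pi\mathfrak g$. If [x] is even in $\mathfrak g$, the sign of the
     $\epsilon$-term agrees with axiom (iii); if [x] is odd in $\mathfrak g$, the signs differ but
     $x(f)=0$. *)
  case: j hx => hx; rewrite /=; first by module F.
  by rewrite (anchor_odd gA f hx) (linearP_0 (linearP_iota0 _)); module F.
(* Axiom (i) on $1=1\cdot1$ gives $L_1=2L_1$. *)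
- move=> v; have := LMul (csa_one A) (csa_one A) v.
  rewrite csa_mul1 -!ia a1 !iota_one => /(congr1 (fun w => w - L0 (0, csa_one A) v)).
  by rewrite addrK subrr.
have LE x v : L (sym_gen a m x) v = L0 x v.
  case: x => x f; rewrite /sym_gen (linearP_D (LlG v)) /= La Lm.
  rewrite -[X in X + _]scale1r -Ll; congr L0; congr (_, _) => /=.
    by rewrite scale1r addr0.
  by rewrite scaler0 add0r.
have comm i j x y : @homog F (Pi (semidirect gA)) i x -> @homog F (Pi (semidirect gA)) j y ->
    lie_commutes L i (sym_gen (gA := gA) a m x) j (sym_gen (gA := gA) a m y).
  by move=> hx hy v; rewrite brE LE (LM (~~ i) (~~ j)) // /scomm !LE.
exists L; split=> //.
have L_homog i X (hX : homog i X) := (Lhd i X hX).1.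
have L_der i X (hX : homog i X) := (Lhd i X hX).2.
apply: gerst_rep_intro => //.
apply: (lie_commutes_all symG iotaP LlG L_homog L_der Lmul).
- by move=> i j f h hf hh; rewrite -!sym_gen_a; apply: comm; apply: pair0_homog.
- move=> i j f x hf hx; rewrite -sym_gen_a -sym_gen_m.
  by apply: comm; [apply: pair0_homog | apply: pairX_homog].
- by move=> i j x y hx hy; rewrite -!sym_gen_m; apply: comm; apply: pairX_homog.
Qed.

End RiggedExtension.

(** * Uniqueness and conclusion *)

Lemma gerst_rep_unique (F : fieldType) (A : comSuperalgebra F) (M : superspace F)
    (act : A -> M -> M) (G : gerstenhaber F) (a : A -> G) (m : M -> G)
    (V : superspace F) (eps : F) (iota iota' : G -> V -> V) (L L' : gerst_lie G -> V -> V) :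
  is_sym_superalgebra act a m ->
  is_gerst_rep iota L -> is_gerst_rep iota' L' ->
  right_leibniz eps iota L -> right_leibniz eps iota' L' ->
  (forall f, iota' (a f) =1 iota (a f)) -> (forall x, iota' (m x) =1 iota (m x)) ->
  (forall f, L' (a f) =1 L (a f)) -> (forall x, L' (m x) =1 L (m x)) ->
  iota' =2 iota /\ L' =2 L.
Proof.
move=> symG [iP [[Ll Lr _] _] der] [iP' [[Ll' Lr' _] _] der'] hL hL' ia im La Lm.
have il v := iota_linl iP v; have il' v := iota_linl iP' v.
pose P (i : bool) (X : G) := forall v, iota' X v = iota X v /\ L' X v = L X v.
have PG : forall i X, homog i X -> P i X.
  apply: (sym_ind symG) => [i c X Y hX hY v|i f _ v|i x _ v|i j X Y hX hY eX eY v].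
  - have [ex lx] := hX v; have [ey ly] := hY v.
    by rewrite il il' ex ey Ll Ll' lx ly.
  - by rewrite ia La.
  - by rewrite im Lm.
  have iM := iota_mul iP; have iM' := iota_mul iP'.
  split; first by rewrite iM iM' (eY v).1 (eX _).1.
  (* The induction hypotheses say nothing about $[X,Y]$, so $\iota_{[X,Y]}$ is rewritten as
     $[L_X,\iota_Y]$, which involves only the operators of $X$ and $Y$. *)
  rewrite (hL _ _ _ _ v hX hY) (hL' _ _ _ _ v hX hY) -(der _ _ _ _ v hX hY) -(der' _ _ _ _ v hX hY).
  by rewrite /scomm (eY v).2 (eX _).1 (eY v).1 !(eX _).2 (eY _).1.
split=> X v.
  by apply: (homog_ext (il' v) (il v)) => i Y hY; have [] := PG _ _ hY v.
by apply: (homog_ext (Ll' v) (Ll v)) => i Y hY; have [] := PG _ _ hY v.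
Qed.

Theorem theorem2p18 (F : fieldType) (charF0 : [pchar F] =i pred0)
    (g : lieSuperalgebra F) (A : comSuperalgebra F)
    (gA : lieSuperalgebroid g A) (eps : F)
    (G : gerstenhaber F) (a : A -> G) (m : Pi g -> G)
    (GS : is_schouten_algebra gA a m)
    (V : superspace F)
    (iota0 : Pi (semidirect gA) -> V -> V) (L0 : semidirect gA -> V -> V)
    (R0 : is_eps_rigged eps iota0 L0) :
  (exists (iota : G -> V -> V) (L : gerst_lie G -> V -> V),
    [/\ is_gerst_rep iota L,
        (forall x v, iota (sym_gen a m x) v = iota0 x v),
        (forall x v, L (sym_gen a m x) v = L0 x v),
        right_leibniz eps iota L
      & forall (iota' : G -> V -> V) (L' : gerst_lie G -> V -> V),
          is_gerst_rep iota' L' ->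
          (forall x v, iota' (sym_gen a m x) v = iota0 x v) ->
          (forall x v, L' (sym_gen a m x) v = L0 x v) ->
          right_leibniz eps iota' L' ->
          iota' =2 iota /\ L' =2 L])
  /\ (forall (iota : G -> V -> V) (L : gerst_lie G -> V -> V),
        is_gerst_rep iota L ->
        right_leibniz eps iota L <-> right_leibniz' eps iota L).
Proof.
split; last by move=> iota L; apply: right_leibniz_equiv.
have [iota [iotaP iE]] := rigged_iota_ext GS R0.
have [L [rep LE hL]] := rigged_L_ext GS R0 iotaP iE.
exists iota, L; split=> // iota' L' rep' iE' LE' hL'.
have am (x : g) := sym_gen_m GS x; have aa (f : A) := sym_gen_a GS f.
apply: (gerst_rep_unique GS.1 rep rep' hL hL') => [f|x|f|x] v.
- by rewrite -aa iE iE'.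
- by rewrite -am iE iE'.
- by rewrite -aa LE LE'.
- by rewrite -am LE LE'.
Qed.
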